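(* Let $0<p<q\le 1$, $\tau\ge 0$, $0\le\eta<1$, $\kappa,\xi\in\mathbb{N}_0$, $0\le\rho<1$, and let $\varphi\in\mathcal{P}_{p,q}^{\xi,\kappa}(\tau,\eta)$, $\varphi(z)=z-\sum_{\nu=2}^{\infty}c_\nu z^\nu$ with $c_\nu\ge0$. Then $\varphi$ is starlike of order $\rho$ in $|z|<r_2$, where $$r_2:=\inf_{\nu\ge2}\left(\frac{(1-\rho)[\nu]_{p,q}^{\kappa}(\nu-\eta)\big\{1+([\nu]_{p,q}-1)\tau\big\}[1+(\nu-1)\tau]^{\xi}}{(\nu-\rho)(1-\eta)}\right)^{1/(\nu-1)} .$$ The result is sharp, with extremal function $$\varphi(z)=z-\frac{1-\eta}{[\nu]_{p,q}^{\kappa}(\nu-\eta)\big\{1+([\nu]_{p,q}-1)\tau\big\}[1+(\nu-1)\tau]^{\xi}}\,z^{\nu}\qquad(\nu\ge2).$$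
   Context: $\Omega=\{z\in\mathbb{C}:|z|<1\}$; $\mathbb{N}_0=\mathbb{N}\cup\{0\}$. $\mathcal{A}$ is the class of analytic functions $\varphi$ on $\Omega$ with $\varphi(0)=0$, $\varphi'(0)=1$, so $\varphi(z)=z+\sum_{\nu\ge2}c_\nu z^\nu$. For $0<p<q\le1$, $[\nu]_{p,q}=\frac{p^\nu-q^\nu}{p-q}=\sum_{j=0}^{\nu-1}p^{\nu-1-j}q^{j}$. For $\varphi\in\mathcal{A}$, $\tau\ge0$, $\kappa,\xi\in\mathbb{N}_0$ define the operator $$\Upsilon_{\tau,p,q}^{\xi,\kappa}\varphi(z)=z+\sum_{\nu=2}^{\infty}[\nu]_{p,q}^{\kappa}[1+(\nu-1)\tau]^{\xi}c_\nu z^\nu .$$ For $0\le\eta<1$, $\tau\ge0$, $\mathcal{Q}_{p,q}^{\xi,\kappa}(\tau,\eta)$ is the class of $\varphi\in\mathcal{A}$ such that for all $z\in\Omega$ $$\operatorname{Re}\left\{\frac{(1-\tau)z\big(\Upsilon_{\tau,p,q}^{\xi,\kappa}\varphi(z)\big)'+\tau z\big(\Upsilon_{\tau,p,q}^{\xi,\kappa+1}\varphi(z)\big)'}{(1-\tau)\Upsilon_{\tau,p,q}^{\xi,\kappa}\varphi(z)+\tau\Upsilon_{\tau,p,q}^{\xi,\kappa+1}\varphi(z)}\right\}>\eta .$$ $\mathcal{T}$ is the subclass of $\mathcal{A}$ of functions of the form $\varphi(z)=z-\sum_{\nu=2}^{\infty}c_\nu z^\nu$ with all $c_\nu\ge0$,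 and $\mathcal{P}_{p,q}^{\xi,\kappa}(\tau,\eta)=\mathcal{Q}_{p,q}^{\xi,\kappa}(\tau,\eta)\cap\mathcal{T}$. Starlike of order $\rho$ in $|z|<r$ means $\operatorname{Re}\{z\varphi'(z)/\varphi(z)\}>\rho$ for $|z|<r$ (with value $1$ at $z=0$). ''Sharp'' means that the radius cannot be replaced by a larger one valid for all functions in the class.
   Formalization: The formal theorem assumes 1+([ν]_{p,q}−1)τ > 0 for all ν ≥ 2, i.e. τ ≤ 1 or q = 1; if τ > 1 and q < 1 this factor is negative for large ν, so r_2 contains even roots of negative numbers and the extremal functions leave the class T. *)

(* Defs.v *)
From Stdlib Require Import Reals ClassicalEpsilon.
From Coquelicot Require Import Coquelicot.

Open Scope R_scope.

Definition in_disc (z : C) : Prop := Cmod z < 1.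

(* Analytic on the open unit disc, i.e. complex differentiable at each of its
   points.  Values outside the disc are unconstrained. *)
Definition analytic_disc (f : C -> C) : Prop :=
  forall z : C, in_disc z -> ex_derive f z.

Definition class_A (f : C -> C) : Prop :=
  analytic_disc f /\ f (RtoC 0) = RtoC 0 /\ C_derive f (RtoC 0) = RtoC 1.

(* The coefficients of the expansion of [f] at 0; the sequence exists (and is
   unique) for every [f] analytic on the disc. *)
Definition taylor (f : C -> C) : nat -> C :=
  epsilon (inhabits (fun _ : nat => RtoC 0))
    (fun c => forall z : C, in_disc z ->
       is_series (fun n => (c n * z ^ n)%C) (f z)).

(* Coquelicot's [Series] is real-valued. *)
Definition CSeries (a : nat -> C) : C :=
  (Series (fun n => Re (a n)), Series (fun n => Im (a n))).

Definition pq_number (p q : R) (nu : nat) : R := (p ^ nu - q ^ nu) / (p - q).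

(* The sum over [nu >= 2] is indexed by [n = nu - 2]. *)
Definition Upsilon (tau p q : R) (xi kappa : nat) (f : C -> C) (z : C) : C :=
  (z + CSeries (fun n =>
         let nu := S (S n) in
         RtoC (pq_number p q nu ^ kappa * (1 + (INR nu - 1) * tau) ^ xi)
         * taylor f nu * z ^ nu))%C.

(* The quotient of two functions vanishing at the origin, with the value 1
   at [z = 0], where the singularity is removable.  If [den] vanishes at some
   other point, the quotient is [0] there, since [Cinv] maps 0 to 0; hence
   [eta < Re _] with [0 <= eta] excludes such points. *)
Definition quotient_at (z num den : C) : C :=
  if Ceq_dec z (RtoC 0) then RtoC 1 else (num / den)%C.

Definition class_Q (p q : R) (xi kappa : nat) (tau eta : R) (f : C -> C)
  : Prop :=
  class_A f /\
  forall z : C, in_disc z ->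
    let U0 := Upsilon tau p q xi kappa f in
    let U1 := Upsilon tau p q xi (S kappa) f in
    eta < Re (quotient_at z
      (RtoC (1 - tau) * z * C_derive U0 z + RtoC tau * z * C_derive U1 z)%C
      (RtoC (1 - tau) * U0 z + RtoC tau * U1 z)%C).

(* [is_series _ (z - f z)] says that the series converges and that
   [f z = z - sum]. *)
Definition class_T (f : C -> C) : Prop :=
  class_A f /\
  exists c : nat -> R,
    (forall nu : nat, (2 <= nu)%nat -> 0 <= c nu) /\
    (forall z : C, in_disc z ->
       is_series (fun n => (RtoC (c (S (S n))) * z ^ (S (S n)))%C)
                 (z - f z)%C).

Definition class_P (p q : R) (xi kappa : nat) (tau eta : R) (f : C -> C)
  : Prop :=
  class_Q p q xi kappa tau eta f /\ class_T f.

Definition starlike (rho r : R) (f : C -> C) : Prop :=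
  forall z : C, Cmod z < r ->
    rho < Re (quotient_at z (z * C_derive f z)%C (f z)).

Definition weight (p q : R) (xi kappa : nat) (tau eta : R) (nu : nat) : R :=
  pq_number p q nu ^ kappa * (INR nu - eta)
  * (1 + (pq_number p q nu - 1) * tau) * (1 + (INR nu - 1) * tau) ^ xi.

(* [Rpower] is the real root only for a positive base. *)
Definition radius_at (p q : R) (xi kappa : nat) (tau eta rho : R) (nu : nat)
  : R :=
  Rpower ((1 - rho) * weight p q xi kappa tau eta nu
          / ((INR nu - rho) * (1 - eta)))
         (1 / (INR nu - 1)).

(* The set is nonempty and bounded below by 0, so the infimum is finite. *)
Definition r2 (p q : R) (xi kappa : nat) (tau eta rho : R) : R :=
  real (Glb_Rbar (fun x => exists nu : nat,
    (2 <= nu)%nat /\ x = radius_at p q xi kappa tau eta rho nu)).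

Definition extremal (p q : R) (xi kappa : nat) (tau eta : R) (nu : nat)
  (z : C) : C :=
  (z - RtoC ((1 - eta) / weight p q xi kappa tau eta nu) * z ^ nu)%C.

(* Main.v *)
(* For [D z = z - sum a_n z^n] with [a_n >= 0] and [N z = z D'(z)], the
   inequality [|N - D| < (1 - eta) |D|], which forces [Re (N / D) > eta], holds
   at [|z| = r] as soon as [sum (n - eta) a_n r^(n-1) < 1 - eta].  Conversely,
   [N / D > eta] on (0, 1) forces [D > 0] there by the intermediate value
   theorem, and letting [r] tend to 1 gives [sum (n - eta) a_n <= 1 - eta].
   Applied to the mixture of the two operators, this is the coefficient
   inequality [sum weight(n) c_n <= 1 - eta] for the class, and [r < r2] turns it
   into the sufficient condition of order [rho] for [phi] itself.  The extremal
   function attains the value [rho] at the real point [radius_at nu]. *)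

Require Import Defs.
From Stdlib Require Import Reals Lra Lia ClassicalEpsilon Ranalysis5.
From Coquelicot Require Import Coquelicot.
Open Scope R_scope.

(** * Complex series and power series *)

(** The overview treats the class as a condition on coefficients, but [class_Q] speaks of
    derivatives of an operator whose coefficients come from [epsilon]. The bridge is uniqueness of
    expansions together with termwise differentiation: on [class_T], the numerator and denominator
    both become [z] minus a power series with real coefficients ([cpser]), where z d/dz multiplies
    the n-th coefficient by n. Complex estimates are made on [cpser]; its restriction to the real
    axis is Coquelicot's [PSeries], which supplies continuity for the intermediate value argument.
    The criterion for Re (N / D) is kept free in its order and coefficients because it is needed
    twice: with [eta] and the mixed coefficients for the extremal functions, and with [rho] and the
    original ones for [phi]. The multipliers grow polynomially in n, which preserves the radius of
    convergence and also confines [r2] to the unit interval. *)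

Lemma is_series_C_components (u : nat -> C) (l : C) :
  is_series u l ->
  is_series (fun n => Re (u n)) (Re l) /\ is_series (fun n => Im (u n)) (Im l).
Proof.
intros H.
assert (E : forall N, sum_n u N = (sum_n (fun n => Re (u n)) N, sum_n (fun n => Im (u n)) N) :> C).
{ induction N as [|N IH].
  - rewrite !sum_O. now destruct (u 0%nat).
  - rewrite !sum_Sn, IH. reflexivity. }
split; intros P [eps HP].
- destruct (H (fun x => P (fst x))) as [N HN].
  + exists eps. intros y [Hy _]. apply HP, Hy.
  + exists N. intros n Hn. specialize (HN n Hn). now rewrite E in HN.
- destruct (H (fun x => P (snd x))) as [N HN].
  + exists eps. intros y [_ Hy]. apply HP, Hy.
  + exists N. intros n Hn. specialize (HN n Hn). now rewrite E in HN.
Qed.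

Lemma CSeries_unique (u : nat -> C) (l : C) : is_series u l -> CSeries u = l.
Proof.
intros H. destruct (is_series_C_components u l H) as [H1 H2].
unfold CSeries. rewrite (is_series_unique _ _ H1), (is_series_unique _ _ H2).
now destruct l.
Qed.

(** Completeness of C gives some limit, and uniqueness identifies it with the componentwise sums. *)
Lemma CSeries_correct (u : nat -> C) :
  ex_series (fun n => Cmod (u n)) -> is_series u (CSeries u).
Proof.
intros H.
destruct (ex_series_le (V := C_CompleteNormedModule) u (fun n => Cmod (u n))) as [l Hl].
- intros n. apply Rle_refl.
- exact H.
- rewrite (CSeries_unique u l); exact Hl.
Qed.

Lemma sum_n_le_Series (u : nat -> R) (N : nat) :
  (forall n, 0 <= u n) -> ex_series u -> sum_n u N <= Series u.
Proof.
intros Hu He.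
assert (L : is_lim_seq (sum_n u) (Series u)) by exact (Series_correct _ He).
apply (is_lim_seq_incr_compare _ _ L).
intros n. rewrite sum_Sn. unfold plus; simpl. specialize (Hu (S n)). lra.
Qed.

Lemma Series_le_bound (u : nat -> R) (M : R) :
  ex_series u -> (forall N, sum_n u N <= M) -> Series u <= M.
Proof.
intros He HM.
apply (is_lim_seq_le (sum_n u) (fun _ => M) (Series u) M HM).
- exact (Series_correct _ He).
- apply is_lim_seq_const.
Qed.

Lemma Cmod_CSeries_le (u : nat -> C) :
  ex_series (fun n => Cmod (u n)) ->
  Cmod (CSeries u) <= Series (fun n => Cmod (u n)).
Proof.
intros H.
assert (L : is_lim_seq (fun N => Cmod (sum_n u N)) (Cmod (CSeries u))).
{ apply (filterlim_comp _ _ _ _ _ _ _ _ (CSeries_correct u H)).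
  exact (filterlim_norm (V := C_NormedModule) _). }
set (M := Series (fun n => Cmod (u n))).
apply (is_lim_seq_le _ (fun _ => M) (Cmod (CSeries u)) M) with (2 := L).
- intros N. apply Rle_trans with (sum_n (fun n => Cmod (u n)) N).
  + exact (norm_sum_n_m (V := C_NormedModule) u 0 N).
  + apply sum_n_le_Series; auto using Cmod_ge_0.
- apply is_lim_seq_const.
Qed.

(** Generic in the module, since it serves both complex monomials and real majorants. The induction
    shifts the one nonzero term down to index 0. *)
Lemma is_series_single {K : AbsRing} {V : NormedModule K} (u : nat -> V) (nu : nat) :
  (forall n, n <> nu -> u n = zero) -> is_series u (u nu).
Proof.
revert u. induction nu as [|nu IH]; intros u Hu; apply is_series_decr_1.
- replace (plus (u 0%nat) (opp (u 0%nat))) with (@zero V)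
    by (symmetry; apply (plus_opp_r (u 0%nat))).
  unfold is_series.
  apply filterlim_ext with (fun _ : nat => @zero V).
  + intros N. symmetry. induction N as [|N IHN].
    * rewrite sum_O. now apply Hu.
    * rewrite sum_Sn, IHN, Hu, plus_zero_l; auto.
  + apply filterlim_const.
- replace (plus (u (S nu)) (opp (u 0%nat))) with (u (S nu)).
  2:{ rewrite (Hu 0%nat) by lia. symmetry. apply (minus_zero_r (u (S nu))). }
  apply (IH (fun n => u (S n))). intros n Hn. apply Hu. lia.
Qed.

Definition cpser (a : nat -> R) (z : C) : C :=
  CSeries (fun n => (RtoC (a n) * z ^ n)%C).

Lemma Cmod_term (a : R) (z : C) (n : nat) :
  Cmod (RtoC a * z ^ n)%C = Rabs a * Cmod z ^ n.
Proof. now rewrite Cmod_mult, Cmod_R, Cmod_pow. Qed.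

Lemma cpser_correct (a : nat -> R) (z : C) :
  ex_series (fun n => Rabs (a n) * Cmod z ^ n) ->
  is_series (fun n => (RtoC (a n) * z ^ n)%C) (cpser a z).
Proof.
intros H. apply CSeries_correct. 
eapply ex_series_ext; [|exact H]. intros n. symmetry. apply Cmod_term.
Qed.

Lemma ex_series_pow_le (a b : nat -> R) (r s : R) :
  0 <= r <= s -> (forall n, Rabs (a n) <= Rabs (b n)) ->
  ex_series (fun n => Rabs (b n) * s ^ n) ->
  ex_series (fun n => Rabs (a n) * r ^ n).
Proof.
intros Hrs Hab H.
apply (@ex_series_le R_AbsRing R_CompleteNormedModule) with (2 := H).
intros n. change (norm (Rabs (a n) * r ^ n)) with (Rabs (Rabs (a n) * r ^ n)).
assert (0 <= r ^ n) by (apply pow_le; lra).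
rewrite Rabs_pos_eq by (apply Rmult_le_pos; auto using Rabs_pos).
apply Rmult_le_compat; auto using Rabs_pos. now apply pow_incr.
Qed.

(** Bernoulli's inequality for [/ t], seen as 1 plus [/ t - 1]. *)
Lemma linear_geometric_bound (t : R) :
  0 < t < 1 -> forall n, INR n * t ^ n <= / (/ t - 1).
Proof.
intros Ht n.
assert (Hi : 1 < / t) by (rewrite <- Rinv_1 at 1; apply Rinv_lt_contravar; lra).
assert (B := poly n (/ t - 1) ltac:(lra)).
replace (1 + (/ t - 1)) with (/ t) in B by ring.
rewrite pow_inv in B.
assert (P : 0 < t ^ n) by (apply pow_lt; lra).
assert (B' : (1 + INR n * (/ t - 1)) * t ^ n <= 1).
{ replace 1 with (/ t ^ n * t ^ n) at 3 by (field; lra).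
  apply Rmult_le_compat_r; lra. }
apply (Rmult_le_reg_r (/ t - 1)); [lra|].
rewrite Rinv_l by lra. nra.
Qed.

Lemma ex_series_INR_mult (a : nat -> R) (r s : R) :
  0 <= s < r -> ex_series (fun n => Rabs (a n) * r ^ n) ->
  ex_series (fun n => Rabs (INR n * a n) * s ^ n).
Proof.
intros Hrs H.
(* [s] may be 0, whereas the bound on [INR n * t ^ n] needs a positive ratio, so the comparison is
   made at the midpoint [u]. *)
set (u := (s + r) / 2).
assert (Hu : 0 < u < r) by (unfold u; lra).
assert (Ht : 0 < u / r < 1).
{ split; [apply Rdiv_lt_0_compat; lra|]. apply Rlt_div_l; lra. }
assert (B := linear_geometric_bound _ Ht).
set (M := / (/ (u / r) - 1)) in *.
apply ex_series_pow_le with (b := fun n => INR n * a n) (s := u).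
- unfold u; lra.
- intros; lra.
- assert (HM : ex_series (fun n => M * (Rabs (a n) * r ^ n))).
  { now apply ex_series_scal_l with (c := M) in H. }
  apply (@ex_series_le R_AbsRing R_CompleteNormedModule) with (2 := HM).
  intros n.
  change (norm (Rabs (INR n * a n) * u ^ n)) with (Rabs (Rabs (INR n * a n) * u ^ n)).
  assert (0 < u ^ n) by (apply pow_lt; lra).
  assert (0 < r ^ n) by (apply pow_lt; lra).
  rewrite Rabs_mult, Rabs_Rabsolu, (Rabs_pos_eq (u ^ n)), Rabs_mult by lra.
  rewrite (Rabs_pos_eq (INR n)) by apply pos_INR.
  specialize (B n).
  replace (INR n * Rabs (a n) * u ^ n) with (INR n * (u / r) ^ n * (Rabs (a n) * r ^ n)).
  + apply Rmult_le_compat_r; auto. apply Rmult_le_pos; [apply Rabs_pos|lra].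
  + unfold Rdiv. rewrite Rpow_mult_distr, pow_inv. field. lra.
Qed.

(** The remainder of degree n + 2 is z + h times the previous one plus (n + 1) z^n h^2, and N^2 + N
    is at most (N + 1)^2. The factor [s] on the left avoids the exponent n - 1, which would be
    truncated at n = 0. *)
Lemma power_remainder_bound (z h : C) (s : R) (n : nat) :
  Cmod z <= s -> Cmod (z + h) <= s ->
  s * Cmod ((z + h) ^ S n - z ^ S n - RtoC (INR (S n)) * z ^ n * h)%C
  <= INR (S n) ^ 2 * s ^ n * Cmod h ^ 2.
Proof.
intros Hz Hw.
assert (Hs : 0 <= s) by (eapply Rle_trans; [apply Cmod_ge_0|exact Hz]).
assert (Hh := Cmod_ge_0 h).
induction n as [|n IH].
- simpl INR. 
  replace (((z + h) ^ 1 - z ^ 1 - RtoC 1 * z ^ 0 * h)%C) with (RtoC 0) by (simpl; ring).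
  rewrite Cmod_0. simpl. nra.
- set (D := ((z + h) ^ S n - z ^ S n - RtoC (INR (S n)) * z ^ n * h)%C) in *.
  replace (((z + h) ^ S (S n) - z ^ S (S n) - RtoC (INR (S (S n))) * z ^ S n * h)%C)
    with ((z + h) * D + RtoC (INR (S n)) * z ^ n * h ^ 2)%C.
  2:{ unfold D. rewrite (S_INR (S n)), RtoC_plus. simpl Cpow. ring. }
  assert (T := Cmod_triangle ((z + h) * D) (RtoC (INR (S n)) * z ^ n * h ^ 2)).
  rewrite !Cmod_mult, Cmod_R, !Cmod_pow, (Rabs_pos_eq (INR (S n))) in T by apply pos_INR.
  assert (Zn : Cmod z ^ n <= s ^ n) by (apply pow_incr; split; auto using Cmod_ge_0).
  assert (HN := pos_INR (S n)).
  assert (Pn : 0 <= s ^ n) by now apply pow_le.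
  assert (A1 : Cmod (z + h) * Cmod D <= s * Cmod D)
    by (apply Rmult_le_compat_r; auto using Cmod_ge_0).
  assert (H2 : 0 <= Cmod h ^ 2) by apply pow2_ge_0.
  assert (A2 : INR (S n) * Cmod z ^ n * Cmod h ^ 2 <= INR (S n) * s ^ n * Cmod h ^ 2).
  { apply Rmult_le_compat_r; auto. apply Rmult_le_compat_l; auto. }
  apply Rle_trans with (s * (INR (S n) ^ 2 * s ^ n * Cmod h ^ 2 + INR (S n) * s ^ n * Cmod h ^ 2)).
  + apply Rmult_le_compat_l; lra.
  + rewrite (S_INR (S n)). set (N := INR (S n)) in *.
    replace (s * (N ^ 2 * s ^ n * Cmod h ^ 2 + N * s ^ n * Cmod h ^ 2)) 
      with ((N ^ 2 + N) * (s ^ S n * Cmod h ^ 2)) by (simpl; ring).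
    rewrite Rmult_assoc. apply Rmult_le_compat_r; [|nra].
    apply Rmult_le_pos; auto. now apply pow_le.
Qed.

Lemma is_derive_C_quadratic (f : C -> C) (z l : C) (d K : R) :
  0 < d ->
  (forall h : C, Cmod h < d -> Cmod (f (z + h) - f z - h * l)%C <= K * Cmod h ^ 2) ->
  is_derive f z l.
Proof.
intros Hd H. split.
- apply is_linear_scal_l.
- intros x Hx. 
  assert (E := is_filter_lim_locally_unique (V := AbsRing_NormedModule C_AbsRing) z x Hx).
  subst x.
  intros [eps Heps]; simpl.
  assert (HK : 0 < Rabs K + 1) by (assert (X := Rabs_pos K); lra).
  (* Within this distance K |h| is at most [eps]; [Rabs K + 1] is a positive divisor whatever the
     sign of [K]. *)
  set (e := Rmin d (eps / (Rabs K + 1))).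
  assert (He : 0 < e).
  { apply Rmin_pos; auto. now apply Rdiv_lt_0_compat. }
  exists (mkposreal e He). intros y Hy.
  change (Cmod (y - z)%C < e) in Hy.
  change (norm (minus (minus (f y) (f z)) (scal (minus y z) l)))
    with (Cmod (f y - f z - (y - z) * l)%C).
  change (norm (minus y z)) with (Cmod (y - z)%C).
  specialize (H (y - z)%C).
  assert (Ey : forall v w : C, (v + (w - v))%C = w) by (intros; ring).
  rewrite Ey in H.
  assert (Cmod (y - z)%C < d) by (eapply Rlt_le_trans; [exact Hy|apply Rmin_l]).
  eapply Rle_trans; [apply H; auto|].
  assert (B : Cmod (y - z) < eps / (Rabs K + 1)) by (eapply Rlt_le_trans; [exact Hy|apply Rmin_r]).
  apply (Rmult_lt_compat_r (Rabs K + 1)) in B; auto.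
  replace (eps / (Rabs K + 1) * (Rabs K + 1)) with eps in B by (field; lra).
  assert (C0 := Cmod_ge_0 (y - z)). assert (X := Rle_abs K).
  replace (K * Cmod (y - z) ^ 2) with (K * Cmod (y - z) * Cmod (y - z)) by ring.
  apply Rmult_le_compat_r; auto. nra.
Qed.

(** This and the following restatements fix the operations to those of the field C, so that [ring]
    and [replace] recognise them. *)
Lemma is_series_C_ext (u v : nat -> C) (l : C) :
  (forall n, u n = v n) -> is_series u l -> is_series v l.
Proof. apply is_series_ext. Qed.

Lemma is_series_C_minus (u v : nat -> C) (l m : C) :
  is_series u l -> is_series v m -> is_series (fun n => (u n - v n)%C) (l - m)%C.
Proof. exact (is_series_minus (V := C_NormedModule) u v l m). Qed.

Lemma is_series_C_scal (c : C) (u : nat -> C) (l : C) :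
  is_series u l -> is_series (fun n => (c * u n)%C) (c * l)%C.
Proof. exact (is_series_scal_l (V := C_NormedModule) c u l). Qed.

Lemma is_series_C_shift (u : nat -> C) (l : C) :
  is_series u l -> is_series (fun n => u (S n)) (l - u 0%nat)%C.
Proof.
intros H. apply is_series_incr_1.
change (is_series u (l - u 0%nat + u 0%nat)%C).
now replace (l - u 0%nat + u 0%nat)%C with l by ring.
Qed.

Lemma Cmod_series_le (u : nat -> C) (l : C) (v : nat -> R) :
  is_series u l -> (forall n, Cmod (u n) <= v n) -> ex_series v ->
  Cmod l <= Series v.
Proof.
intros Hu Huv Hv.
assert (He : ex_series (fun n => Cmod (u n))).
{ apply (@ex_series_le R_AbsRing R_CompleteNormedModule) with (2 := Hv).
  intros n. change (norm (Cmod (u n))) with (Rabs (Cmod (u n))).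
  rewrite Rabs_pos_eq; auto using Cmod_ge_0. }
rewrite <- (CSeries_unique u l Hu).
eapply Rle_trans; [now apply Cmod_CSeries_le|].
apply Series_le; auto using Cmod_ge_0.
Qed.

(** The quadratic remainders of the monomials are summed. Their majorant carries a factor n^2, and
    each factor n is paid for by a smaller radius: from [r] to [(s + r) / 2], then to [s]. *)
Lemma is_derive_cpser (a : nat -> R) (z : C) (r : R) :
  Cmod z < r -> ex_series (fun n => Rabs (a n) * r ^ n) ->
  is_derive (cpser a) z (cpser (PS_derive a) z).
Proof.
intros Hz Ha.
assert (Hz0 := Cmod_ge_0 z).
set (s := (Cmod z + r) / 2).
assert (Hs : Cmod z < s < r) by (unfold s; lra).
assert (H1 : ex_series (fun n => Rabs (INR n * a n) * ((s + r) / 2) ^ n)).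
{ apply ex_series_INR_mult with r; auto; lra. }
assert (H2 : ex_series (fun n => Rabs (INR n * (INR n * a n)) * s ^ n)).
{ apply ex_series_INR_mult with ((s + r) / 2); auto; lra. }
apply ex_series_incr_1 in H2.
set (B := fun n => Rabs (INR (S n) * (INR (S n) * a (S n))) * s ^ S n) in H2.
(* [B] carries s^(n+1) while the remainder of z^(n+1) is bounded with s^(n-1), hence the division by
   [s ^ 2]. *)
apply is_derive_C_quadratic with (d := s - Cmod z) (K := Series B / s ^ 2); [lra|].
intros h Hh.
assert (Hw : Cmod (z + h) < s).
{ eapply Rle_lt_trans; [apply Cmod_triangle|lra]. }
assert (S0 : forall w, Cmod w < s ->
  is_series (fun n => (RtoC (a n) * w ^ n)%C) (cpser a w)).
{ intros w Hws. apply cpser_correct. apply ex_series_pow_le with a r; auto.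
  - split; [apply Cmod_ge_0|lra].
  - intros; lra. }
assert (Sd : is_series (fun n => (RtoC (PS_derive a n) * z ^ n)%C) (cpser (PS_derive a) z)).
{ apply cpser_correct. apply ex_series_pow_le with (PS_derive a) s.
  - lra.
  - intros; lra.
  - apply ex_series_ext with (fun n => / s * (Rabs (INR (S n) * a (S n)) * s ^ S n)).
    + intros n. unfold PS_derive. change (@eq R (/ s * (Rabs (INR (S n) * a (S n)) * s ^ S n))
        (Rabs (INR (S n) * a (S n)) * s ^ n)). simpl pow. field. lra.
    + apply (ex_series_scal_l (/ s) (fun n => Rabs (INR (S n) * a (S n)) * s ^ S n)).
      apply -> (ex_series_incr_1 (fun n => Rabs (INR n * a n) * s ^ n)).
      apply ex_series_INR_mult with r; auto; lra. }
(* The constant terms cancel; dropping index 0 aligns the difference with [PS_derive]. *)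
assert (T := is_series_C_shift _ _ (is_series_C_minus _ _ _ _ (S0 (z + h)%C Hw) (S0 z ltac:(lra)))).
apply (is_series_C_minus _ _ _ _) with (2 := is_series_C_scal h _ _ Sd) in T.
set (l := (cpser a (z + h) - cpser a z - _ - _)%C) in T.
replace (cpser a (z + h) - cpser a z - h * cpser (PS_derive a) z)%C with l
  by (unfold l; simpl; ring).
assert (Hs2 : 0 < s ^ 2) by (apply pow_lt; lra).
apply is_series_C_ext with (v := fun n =>
  (RtoC (a (S n)) * ((z + h) ^ S n - z ^ S n - RtoC (INR (S n)) * z ^ n * h))%C) in T.
2:{ intros n. unfold PS_derive. rewrite RtoC_mult. simpl Cpow. ring. }
replace (Series B / s ^ 2 * Cmod h ^ 2) with (Series (fun n => Cmod h ^ 2 / s ^ 2 * B n))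
  by (rewrite Series_scal_l; field; lra).
apply (Cmod_series_le _ _ _ T).
- intros n. rewrite Cmod_mult, Cmod_R.
  assert (R := power_remainder_bound z h s n ltac:(lra) ltac:(lra)).
  set (D := Cmod ((z + h) ^ S n - _ - _)) in *.
  unfold B. rewrite !Rabs_mult, (Rabs_pos_eq (INR (S n))) by apply pos_INR.
  apply (Rmult_le_reg_l (s ^ 2)); auto.
  replace (s ^ 2 * (Cmod h ^ 2 / s ^ 2 * (INR (S n) * (INR (S n) * Rabs (a (S n))) * s ^ S n)))
    with (s * Rabs (a (S n)) * (INR (S n) ^ 2 * s ^ n * Cmod h ^ 2)).
  2:{ change (s ^ S n) with (s * s ^ n). field. lra. }
  replace (s ^ 2 * (Rabs (a (S n)) * D)) with (s * Rabs (a (S n)) * (s * D)) by ring.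
  apply Rmult_le_compat_l; auto.
  apply Rmult_le_pos; [lra|apply Rabs_pos].
- exact (ex_series_scal_l _ _ H2).
Qed.

(** * Coefficient sequences with radius of convergence at least 1 *)

Definition disc_summable (a : nat -> R) : Prop :=
  forall r, 0 <= r < 1 -> ex_series (fun n => Rabs (a n) * r ^ n).

Lemma disc_summable_le (a b : nat -> R) :
  (forall n, Rabs (a n) <= Rabs (b n)) -> disc_summable b -> disc_summable a.
Proof.
intros Hab Hb r Hr. apply ex_series_pow_le with b r; auto. lra.
Qed.

Lemma disc_summable_INR_mult (a : nat -> R) :
  disc_summable a -> disc_summable (fun n => INR n * a n).
Proof.
intros H r Hr. apply ex_series_INR_mult with ((r + 1) / 2); [lra|].
apply H. lra.
Qed.

Lemma disc_summable_INR_pow_mult (a : nat -> R) (k : nat) :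
  disc_summable a -> disc_summable (fun n => INR n ^ k * a n).
Proof.
intros H. induction k as [|k IH].
- apply disc_summable_le with (2 := H). intros n. simpl. right. f_equal. ring.
- apply disc_summable_le with (2 := disc_summable_INR_mult _ IH).
  intros n. simpl. right. f_equal. ring.
Qed.

Lemma disc_summable_scal (a : nat -> R) (k : R) :
  disc_summable a -> disc_summable (fun n => k * a n).
Proof.
intros H r Hr.
apply ex_series_ext with (fun n => Rabs k * (Rabs (a n) * r ^ n)).
- intros n. rewrite Rabs_mult. change (@eq R (Rabs k * (Rabs (a n) * r ^ n)) (Rabs k * Rabs (a n) * r ^ n)).
  ring.
- exact (ex_series_scal_l _ _ (H r Hr)).
Qed.

(** The bound concerns [w n * a n] rather than [w n]: at n = 0 the power of [INR n] may vanish while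
    [w 0] does not, and then [a 0 = 0] is what saves it. *)
Lemma disc_summable_poly_mult (a w : nat -> R) (K : R) (k : nat) :
  (forall n, Rabs (w n * a n) <= K * INR n ^ k * Rabs (a n)) ->
  disc_summable a -> disc_summable (fun n => w n * a n).
Proof.
intros Hw Ha.
apply disc_summable_le with (fun n => K * (INR n ^ k * a n)).
- intros n. eapply Rle_trans; [apply Hw|].
  assert (P : 0 <= INR n ^ k) by (apply pow_le, pos_INR).
  rewrite !Rabs_mult, (Rabs_pos_eq (INR n ^ k)) by auto. rewrite <- Rmult_assoc.
  apply Rmult_le_compat_r; [apply Rabs_pos|].
  apply Rmult_le_compat_r; auto. apply Rle_abs.
- now apply disc_summable_scal, disc_summable_INR_pow_mult.
Qed.

Lemma disc_summable_1 : disc_summable (fun _ => 1).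
Proof.
intros r Hr. apply ex_series_ext with (fun n => r ^ n).
- intros n. rewrite Rabs_R1. now rewrite Rmult_1_l.
- apply ex_series_geom. rewrite Rabs_pos_eq; lra.
Qed.

Lemma disc_summable_cpser (a : nat -> R) (z : C) :
  disc_summable a -> in_disc z ->
  is_series (fun n => (RtoC (a n) * z ^ n)%C) (cpser a z).
Proof. intros Ha Hz. apply cpser_correct, Ha. split; auto using Cmod_ge_0. Qed.

Lemma cpser_unique (a : nat -> R) (z l : C) :
  is_series (fun n => (RtoC (a n) * z ^ n)%C) l -> cpser a z = l.
Proof. apply CSeries_unique. Qed.

Lemma cpser_linear (a b : nat -> R) (s t : R) (z : C) :
  disc_summable a -> disc_summable b -> in_disc z ->
  cpser (fun n => s * a n + t * b n) z = (RtoC s * cpser a z + RtoC t * cpser b z)%C.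
Proof.
intros Ha Hb Hz. apply cpser_unique.
assert (H := is_series_C_minus _ _ _ _ 
  (is_series_C_scal (RtoC s) _ _ (disc_summable_cpser a z Ha Hz))
  (is_series_C_scal (- RtoC t) _ _ (disc_summable_cpser b z Hb Hz))).
replace (RtoC s * cpser a z + RtoC t * cpser b z)%C
  with (RtoC s * cpser a z - - RtoC t * cpser b z)%C by ring.
apply (is_series_C_ext _ _ _) with (2 := H).
intros n. simpl. rewrite RtoC_plus, !RtoC_mult. ring.
Qed.

Lemma is_derive_cpser_disc (a : nat -> R) (z : C) :
  disc_summable a -> in_disc z -> is_derive (cpser a) z (cpser (PS_derive a) z).
Proof.
intros Ha Hz. unfold in_disc in Hz. assert (Hz0 := Cmod_ge_0 z).
apply is_derive_cpser with ((Cmod z + 1) / 2); [lra|]. apply Ha. lra.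
Qed.

Lemma is_series_C_unshift (u : nat -> C) (l : C) :
  u 0%nat = RtoC 0 -> is_series (fun n => u (S n)) l -> is_series u l.
Proof.
intros H0 H. apply is_series_decr_1.
change (is_series (fun n => u (S n)) (l - u 0%nat)%C). rewrite H0.
now replace (l - 0)%C with l by ring.
Qed.

Lemma cpser_Euler (a : nat -> R) (z : C) (l : C) :
  is_series (fun n => (RtoC (PS_derive a n) * z ^ n)%C) l ->
  cpser (fun n => INR n * a n) z = (z * l)%C.
Proof.
intros H. apply cpser_unique, is_series_C_unshift.
- simpl. rewrite Rmult_0_l. ring.
- apply is_series_C_ext with (2 := is_series_C_scal z _ _ H).
  intros n. unfold PS_derive. rewrite Cpow_S. ring.
Qed.

Lemma disc_summable_PS_derive (a : nat -> R) :
  disc_summable a -> disc_summable (PS_derive a).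
Proof.
intros Ha r Hr.
set (s := (r + 1) / 2). assert (Hs : r < s < 1) by (unfold s; lra).
apply ex_series_pow_le with (PS_derive a) s; [lra|intros; lra|].
assert (H := disc_summable_INR_mult _ Ha s ltac:(lra)).
apply ex_series_incr_1 in H. apply (ex_series_scal_l (/ s)) in H.
apply ex_series_ext with (2 := H).
intros n. unfold PS_derive.
change (@eq R (/ s * (Rabs (INR (S n) * a (S n)) * (s * s ^ n)))
        (Rabs (INR (S n) * a (S n)) * s ^ n)). field. lra.
Qed.

Lemma is_derive_C_id (z : C) : is_derive (V := C_NormedModule) (fun w : C => w) z (RtoC 1).
Proof.
apply is_derive_C_quadratic with (d := 1) (K := 0); [lra|].
intros h _. replace (z + h - z - h * 1)%C with (RtoC 0) by ring.
rewrite Cmod_0. lra.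
Qed.

Lemma is_derive_C_minus (f g : C -> C) (z l m : C) :
  is_derive f z l -> is_derive g z m ->
  is_derive (fun w => (f w - g w)%C) z (l - m)%C.
Proof. exact (is_derive_minus (V := C_NormedModule) f g z l m). Qed.

Lemma is_derive_minus_cpser (a : nat -> R) (z : C) :
  disc_summable a -> in_disc z ->
  is_derive (fun w => (w - cpser a w)%C) z (1 - cpser (PS_derive a) z)%C.
Proof.
intros Ha Hz.
apply is_derive_C_minus; [apply is_derive_C_id|now apply is_derive_cpser_disc].
Qed.

Lemma cpser_real (a : nat -> R) (x : R) : cpser a (RtoC x) = RtoC (PSeries a x).
Proof.
unfold cpser, CSeries, PSeries, RtoC. f_equal.
- apply Series_ext. intros n. fold (RtoC x). fold (RtoC (a n)). rewrite <- RtoC_pow, <- RtoC_mult. reflexivity.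
- rewrite (Series_ext _ (fun n => 0 * 0)), Series_scal_l; [ring|].
  intros n. fold (RtoC x). fold (RtoC (a n)). rewrite <- RtoC_pow, <- RtoC_mult. simpl. ring.
Qed.

(** The numerator differs from the denominator by at most the sum [S3] of (n - 1) d_n |z|^n, and the
    denominator is at least |z| - [S1]. The hypothesis says exactly that [S3] is below 1 - [eta]
    times this lower bound. *)
Lemma starlike_quotient_bound (d : nat -> R) (eta : R) (z : C) :
  (forall n, 0 <= d n) -> d 0%nat = 0 -> eta < 1 ->
  disc_summable d -> in_disc z -> z <> RtoC 0 ->
  Series (fun n => (INR n - eta) * d n * Cmod z ^ n) < (1 - eta) * Cmod z ->
  eta < Re (quotient_at z (z - cpser (fun n => INR n * d n)%R z)%C (z - cpser d z)%C).
Proof.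
intros Hd Hd0 Heta Hs Hz Hz0 HS.
assert (Hr : 0 <= Cmod z < 1) by (split; [apply Cmod_ge_0|exact Hz]).
unfold quotient_at. destruct (Ceq_dec z (RtoC 0)) as [E|_]; [contradiction|].
set (A := cpser d z). set (B := cpser (fun n => INR n * d n) z).
assert (Hn : disc_summable (fun n => INR n * d n)) by now apply disc_summable_INR_mult.
assert (E1 : ex_series (fun n => d n * Cmod z ^ n)).
{ apply ex_series_ext with (2 := Hs _ Hr). intros n. now rewrite Rabs_pos_eq. }
assert (E2 : ex_series (fun n => INR n * d n * Cmod z ^ n)).
{ apply ex_series_ext with (2 := Hn _ Hr). intros n.
  rewrite Rabs_pos_eq; auto. apply Rmult_le_pos; auto using pos_INR. }
set (S1 := Series (fun n => d n * Cmod z ^ n)).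
assert (E3 : ex_series (fun n => INR n * d n * Cmod z ^ n - d n * Cmod z ^ n))
  by now apply (ex_series_minus (V := R_NormedModule)).
set (S3 := Series (fun n => INR n * d n * Cmod z ^ n - d n * Cmod z ^ n)).
assert (HS' : S3 + (1 - eta) * S1 < (1 - eta) * Cmod z).
{ eapply Rle_lt_trans; [|exact HS]. right. unfold S3, S1.
  rewrite <- Series_scal_l, <- Series_plus; auto.
  - apply Series_ext. intros n. ring.
  - exact (ex_series_scal_l _ _ E1). }
assert (HA : Cmod A <= S1).
{ apply (Cmod_series_le _ _ _ (disc_summable_cpser d z Hs Hz)); auto.
  intros n. rewrite Cmod_term, Rabs_pos_eq; auto. lra. }
assert (HB : Cmod (B - A) <= S3).
{ apply (Cmod_series_le _ _ _ (is_series_C_minus _ _ _ _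
    (disc_summable_cpser _ z Hn Hz) (disc_summable_cpser d z Hs Hz))); auto.
  intros n. 
  replace (RtoC (INR n * d n)%R * z ^ n - RtoC (d n) * z ^ n)%C
    with (RtoC ((INR n - 1) * d n)%R * z ^ n)%C
    by (rewrite !RtoC_mult, RtoC_minus; ring).
  rewrite Cmod_term, Rabs_pos_eq; [right; ring|].
  destruct n as [|n]; [rewrite Hd0; lra|].
  apply Rmult_le_pos; auto. rewrite S_INR. assert (X := pos_INR n). lra. }
assert (HD : Cmod z - S1 <= Cmod (z - A)).
{ assert (T := Cmod_triangle (z - A) A).
  replace (z - A + A)%C with z in T by ring. lra. }
assert (HS3 : 0 <= S3) by (eapply Rle_trans; [apply Cmod_ge_0|exact HB]).
(* As [S3] is nonnegative, the strict inequality [HS'] already forces |z| > [S1]. *)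
assert (HP : 0 < Cmod (z - A)) by nra.
assert (HD0 : (z - A)%C <> RtoC 0) by now apply Cmod_gt_0.
replace ((z - B) / (z - A))%C with (1 - (B - A) / (z - A))%C by (field; exact HD0).
assert (HQ : Cmod ((B - A) / (z - A)) < 1 - eta).
{ rewrite Cmod_div by exact HD0. apply Rlt_div_l; auto. nra. }
assert (HR := re_le_Cmod ((B - A) / (z - A))).
assert (HR' := Rle_abs (Re ((B - A) / (z - A)))).
change (eta < 1 - Re ((B - A) / (z - A))). lra.
Qed.

(** * Taylor coefficients and the operator *)

Lemma CV_radius_gt (a : nat -> R) (x s : R) :
  Rabs x < s -> ex_series (fun n => a n * s ^ n) -> Rbar_lt (Rabs x) (CV_radius a).
Proof.
intros Hx Hs.
destruct (Rbar_lt_le_dec (Rabs x) (CV_radius a)) as [H|H]; auto.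
exfalso. apply (CV_disk_outside a s).
- eapply Rbar_le_lt_trans; [exact H|]. simpl. rewrite (Rabs_pos_eq s); auto.
  assert (X := Rabs_pos x). lra.
- now apply ex_series_lim_0.
Qed.

Lemma CV_radius_disc_summable (a : nat -> R) (x : R) :
  disc_summable a -> Rabs x < 1 -> Rbar_lt (Rabs x) (CV_radius a).
Proof.
intros Ha Hx. assert (X := Rabs_pos x).
apply CV_radius_gt with ((Rabs x + 1) / 2); [lra|].
apply ex_series_Rabs.
apply ex_series_ext with (2 := Ha ((Rabs x + 1) / 2) ltac:(lra)).
intros n. rewrite Rabs_mult, (Rabs_pos_eq (_ ^ n)); auto. apply pow_le. lra.
Qed.

Lemma real_power_series_unique (a b : nat -> R) (f : R -> R) :
  (forall x, Rabs x < 1 -> is_series (fun n => a n * x ^ n) (f x)) ->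
  (forall x, Rabs x < 1 -> is_series (fun n => b n * x ^ n) (f x)) ->
  forall n, a n = b n.
Proof.
intros Ha Hb n.
assert (H2 : Rabs (1 / 2) < 1) by (rewrite Rabs_pos_eq; lra).
assert (CV : forall c, (forall x, Rabs x < 1 -> is_series (fun n => c n * x ^ n) (f x)) ->
  Rbar_lt 0 (CV_radius c)).
{ intros c Hc. rewrite <- Rabs_R0. apply CV_radius_gt with (1 / 2).
  - rewrite Rabs_R0; lra.
  - exists (f (1 / 2)). now apply Hc. }
apply PSeries_ext_recip; auto.
exists (mkposreal 1 Rlt_0_1). intros x Hx.
assert (Hx' : Rabs x < 1).
{ change (Rabs (x - 0) < 1) in Hx. now rewrite Rminus_0_r in Hx. }
unfold PSeries. now rewrite (is_series_unique _ _ (Ha x Hx')), (is_series_unique _ _ (Hb x Hx')).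
Qed.

(** At real points the real and imaginary parts of the sum are real power series, with coefficients
    the parts of the complex ones. *)
Lemma complex_power_series_unique (t e : nat -> C) (f : C -> C) :
  (forall z, in_disc z -> is_series (fun n => (t n * z ^ n)%C) (f z)) ->
  (forall z, in_disc z -> is_series (fun n => (e n * z ^ n)%C) (f z)) ->
  forall n, t n = e n.
Proof.
intros Ht He n.
assert (Hd : forall x, Rabs x < 1 -> in_disc (RtoC x)).
{ intros x Hx. unfold in_disc. now rewrite Cmod_R. }
assert (Rm : forall (a : C) x k, Re (a * RtoC x ^ k)%C = Re a * x ^ k).
{ intros a x k. rewrite <- RtoC_pow. unfold Re, Im, Cmult, RtoC, fst, snd. ring. }
assert (Im' : forall (a : C) x k, Im (a * RtoC x ^ k)%C = Im a * x ^ k).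
{ intros a x k. rewrite <- RtoC_pow. unfold Re, Im, Cmult, RtoC, fst, snd. ring. }
assert (HR : Re (t n) = Re (e n)).
{ apply (real_power_series_unique (fun n => Re (t n)) (fun n => Re (e n)) (fun x => Re (f (RtoC x))));
  intros x Hx.
  - apply is_series_ext with (2 := proj1 (is_series_C_components _ _ (Ht _ (Hd x Hx)))).
    intros k. apply Rm.
  - apply is_series_ext with (2 := proj1 (is_series_C_components _ _ (He _ (Hd x Hx)))).
    intros k. apply Rm. }
assert (HI : Im (t n) = Im (e n)).
{ apply (real_power_series_unique (fun n => Im (t n)) (fun n => Im (e n)) (fun x => Im (f (RtoC x))));
  intros x Hx.
  - apply is_series_ext with (2 := proj2 (is_series_C_components _ _ (Ht _ (Hd x Hx)))).
    intros k. apply Im'.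
  - apply is_series_ext with (2 := proj2 (is_series_C_components _ _ (He _ (Hd x Hx)))).
    intros k. apply Im'. }
destruct (t n), (e n). simpl in HR, HI. now subst.
Qed.

(** Any expansion witnesses the predicate given to [epsilon], so the chosen sequence is also an
    expansion and uniqueness applies. *)
Lemma taylor_unique (e : nat -> C) (f : C -> C) :
  (forall z, in_disc z -> is_series (fun n => (e n * z ^ n)%C) (f z)) ->
  forall n, taylor f n = e n.
Proof.
intros He. apply complex_power_series_unique with f; auto.
unfold taylor. apply epsilon_spec. now exists e.
Qed.

Lemma taylor_minus_cpser (c : nat -> R) (f : C -> C) (n : nat) :
  disc_summable c -> c 0%nat = 0 -> c 1%nat = 0 ->
  (forall z, in_disc z -> f z = (z - cpser c z)%C) ->
  taylor f (S (S n)) = RtoC (- c (S (S n))).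
Proof.
intros Hc H0 H1 Hf.
set (e := fun k => match k with 1%nat => RtoC 1 | _ => RtoC (- c k) end).
apply (taylor_unique e f).
intros z Hz. rewrite Hf by auto.
assert (Hid : is_series (fun k => ((match k with 1%nat => RtoC 1 | _ => RtoC 0 end) * z ^ k)%C) z).
{ set (u := fun k => ((match k with 1%nat => RtoC 1 | _ => RtoC 0 end) * z ^ k)%C).
  replace z with (u 1%nat) by (unfold u; simpl; ring).
  apply (is_series_single (V := C_NormedModule) u 1).
  intros [|[|k]] Hk; unfold u; try lia.
  - change (RtoC 0 * z ^ 0 = RtoC 0)%C. ring.
  - change (RtoC 0 * z ^ S (S k) = RtoC 0)%C. ring. }
apply is_series_C_ext with (2 := is_series_C_minus _ _ _ _ Hid (disc_summable_cpser c z Hc Hz)).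
intros [|[|k]]; unfold e.
- rewrite H0, Ropp_0. ring.
- rewrite H1. ring.
- rewrite RtoC_opp. ring.
Qed.

Lemma CSeries_opp (u : nat -> C) : CSeries (fun n => (- u n)%C) = (- CSeries u)%C.
Proof.
unfold CSeries, Copp. simpl. f_equal; apply Series_opp.
Qed.

Lemma CSeries_incr_2 (u : nat -> C) :
  u 0%nat = RtoC 0 -> u 1%nat = RtoC 0 -> CSeries (fun n => u (S (S n))) = CSeries u.
Proof.
intros H0 H1. unfold CSeries. f_equal; symmetry.
- apply (Series_incr_n_aux (fun n => Re (u n)) 2).
  intros [|[|k]] Hk; [now rewrite H0|now rewrite H1|lia].
- apply (Series_incr_n_aux (fun n => Im (u n)) 2).
  intros [|[|k]] Hk; [now rewrite H0|now rewrite H1|lia].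
Qed.

Lemma CSeries_ext (u v : nat -> C) : (forall n, u n = v n) -> CSeries u = CSeries v.
Proof.
intros H. unfold CSeries. f_equal; apply Series_ext; intros n; now rewrite H.
Qed.

Definition Upsilon_factor (tau p q : R) (xi kappa nu : nat) : R :=
  pq_number p q nu ^ kappa * (1 + (INR nu - 1) * tau) ^ xi.

(** Only coefficients are rewritten inside total sums, so the identity holds off the disc too; this
    lets [Upsilon_Euler] differentiate it as a global equality of functions. *)
Lemma Upsilon_minus_cpser (tau p q : R) (xi kappa : nat) (c : nat -> R) (f : C -> C) (z : C) :
  disc_summable c -> c 0%nat = 0 -> c 1%nat = 0 ->
  (forall w, in_disc w -> f w = (w - cpser c w)%C) ->
  Upsilon tau p q xi kappa f z
  = (z - cpser (fun n => Upsilon_factor tau p q xi kappa n * c n)%R z)%C.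
Proof.
intros Hc H0 H1 Hf. unfold Upsilon, Cminus. f_equal.
unfold cpser. rewrite <- CSeries_opp.
rewrite <- (CSeries_incr_2 (fun n => - (RtoC (Upsilon_factor tau p q xi kappa n * c n)%R * z ^ n))%C).
- apply CSeries_ext. intros n. cbv zeta.
  rewrite (taylor_minus_cpser c f n Hc H0 H1 Hf).
  unfold Upsilon_factor. rewrite !RtoC_mult, RtoC_opp. ring.
- rewrite H0, Rmult_0_r. ring.
- rewrite H1, Rmult_0_r. ring.
Qed.

Lemma pq_number_S (p q : R) (n : nat) :
  p <> q -> pq_number p q (S n) = p ^ n + q * pq_number p q n.
Proof. intros H. unfold pq_number. simpl. field. lra. Qed.

(** In the recursion [n+1] = p^n + q [n], both p^n and q are at most 1, so each step adds at most
    1. *)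
Lemma pq_number_bounds (p q : R) (n : nat) :
  0 < p -> p < q -> q <= 1 -> 0 <= pq_number p q n <= INR n.
Proof.
intros Hp Hpq Hq. induction n as [|n IH].
- unfold pq_number. simpl. unfold Rdiv. lra.
- rewrite pq_number_S by lra. rewrite S_INR.
  assert (0 <= p ^ n <= 1).
  { split; [apply pow_le; lra|]. rewrite <- (pow1 n). apply pow_incr. lra. }
  split; nra.
Qed.

Lemma pq_number_pos (p q : R) (n : nat) :
  0 < p -> p < q -> q <= 1 -> (1 <= n)%nat -> 0 < pq_number p q n.
Proof.
intros Hp Hpq Hq Hn. destruct n as [|n]; [lia|].
rewrite pq_number_S by lra. assert (H := pq_number_bounds p q n Hp Hpq Hq).
assert (0 < p ^ n) by (apply pow_lt; lra). nra.
Qed.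

(** The exponent [kappa] comes from [n] <= n, and [xi] from 1 + (n - 1) tau <= (1 + tau) n. *)
Lemma Upsilon_factor_bounds (tau p q : R) (xi kappa n : nat) :
  0 < p -> p < q -> q <= 1 -> 0 <= tau -> (1 <= n)%nat ->
  0 < Upsilon_factor tau p q xi kappa n
  <= (1 + tau) ^ xi * INR n ^ (kappa + xi).
Proof.
intros Hp Hpq Hq Ht Hn. unfold Upsilon_factor.
assert (Hn1 : 1 <= INR n) by (apply (le_INR 1); auto).
assert (P := pq_number_pos p q n Hp Hpq Hq Hn).
assert (P2 := pq_number_bounds p q n Hp Hpq Hq).
assert (T : 1 <= 1 + (INR n - 1) * tau <= (1 + tau) * INR n) by (split; nra).
split.
- apply Rmult_lt_0_compat; apply pow_lt; lra.
- rewrite pow_add, (Rmult_comm (INR n ^ kappa)), <- Rmult_assoc, <- Rpow_mult_distr, Rmult_comm.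
  apply Rmult_le_compat; try (apply pow_le; lra); apply pow_incr; lra.
Qed.

Lemma disc_summable_Upsilon_factor (tau p q : R) (xi kappa : nat) (c : nat -> R) :
  0 < p -> p < q -> q <= 1 -> 0 <= tau -> c 0%nat = 0 ->
  disc_summable c -> disc_summable (fun n => Upsilon_factor tau p q xi kappa n * c n).
Proof.
intros Hp Hpq Hq Ht H0 Hc.
apply disc_summable_poly_mult with ((1 + tau) ^ xi) (kappa + xi)%nat; auto.
intros [|n].
- rewrite H0, Rmult_0_r, Rabs_R0. lra.
- assert (B := Upsilon_factor_bounds tau p q xi kappa (S n) Hp Hpq Hq Ht ltac:(lia)).
  rewrite Rabs_mult, Rabs_pos_eq by lra.
  apply Rmult_le_compat_r; [apply Rabs_pos|lra].
Qed.

Lemma disc_summable_linear (a b : nat -> R) (s t : R) :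
  disc_summable a -> disc_summable b -> disc_summable (fun n => s * a n + t * b n).
Proof.
intros Ha Hb r Hr.
assert (H := ex_series_plus (V := R_NormedModule) _ _ 
  (disc_summable_scal a s Ha r Hr) (disc_summable_scal b t Hb r Hr)).
apply (@ex_series_le R_AbsRing R_CompleteNormedModule) with (2 := H).
intros n. 
change (Rabs (Rabs (s * a n + t * b n) * r ^ n) <= Rabs (s * a n) * r ^ n + Rabs (t * b n) * r ^ n).
assert (0 <= r ^ n) by (apply pow_le; lra).
rewrite Rabs_mult, Rabs_Rabsolu, (Rabs_pos_eq (r ^ n)), <- Rmult_plus_distr_r by auto.
apply Rmult_le_compat_r; auto. apply Rabs_triang.
Qed.

Lemma cpser_ext (a b : nat -> R) (z : C) :
  (forall n, a n = b n) -> cpser a z = cpser b z.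
Proof. intros H. apply CSeries_ext. intros n. now rewrite H. Qed.

Lemma disc_summable_ext (a b : nat -> R) :
  (forall n, a n = b n) -> disc_summable a -> disc_summable b.
Proof. intros H. apply disc_summable_le. intros n. rewrite H. lra. Qed.

(* The coefficient multiplier of (1 - tau) Upsilon^(xi,kappa) + tau Upsilon^(xi,kappa+1). *)
Definition mixed_factor (tau p q : R) (xi kappa nu : nat) : R :=
  Upsilon_factor tau p q xi kappa nu * (1 + (pq_number p q nu - 1) * tau).

Lemma mixed_factor_linear (tau p q : R) (xi kappa : nat) (c : nat -> R) (n : nat) :
  (1 - tau) * (Upsilon_factor tau p q xi kappa n * c n)
  + tau * (Upsilon_factor tau p q xi (S kappa) n * c n)
  = mixed_factor tau p q xi kappa n * c n.
Proof. unfold mixed_factor, Upsilon_factor. simpl. ring. Qed.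

Lemma disc_summable_mixed_factor (tau p q : R) (xi kappa : nat) (c : nat -> R) :
  0 < p -> p < q -> q <= 1 -> 0 <= tau -> c 0%nat = 0 ->
  disc_summable c -> disc_summable (fun n => mixed_factor tau p q xi kappa n * c n).
Proof.
intros Hp Hpq Hq Ht H0 Hc.
apply disc_summable_ext with (1 := mixed_factor_linear tau p q xi kappa c).
apply disc_summable_linear; now apply disc_summable_Upsilon_factor.
Qed.

Lemma Upsilon_Euler (tau p q : R) (xi kappa : nat) (c : nat -> R) (f : C -> C) (z : C) :
  0 < p -> p < q -> q <= 1 -> 0 <= tau ->
  disc_summable c -> c 0%nat = 0 -> c 1%nat = 0 ->
  (forall w, in_disc w -> f w = (w - cpser c w)%C) -> in_disc z ->
  (z * C_derive (Upsilon tau p q xi kappa f) z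
  = z - cpser (fun n => INR n * (Upsilon_factor tau p q xi kappa n * c n))%R z)%C.
Proof.
intros Hp Hpq Hq Ht Hc H0 H1 Hf Hz.
assert (Hs := disc_summable_Upsilon_factor tau p q xi kappa c Hp Hpq Hq Ht H0 Hc).
rewrite (is_C_derive_unique _ _ (1 - cpser (PS_derive (fun n => Upsilon_factor tau p q xi kappa n * c n)%R) z)%C).
- rewrite (cpser_Euler _ z _ (disc_summable_cpser _ z (disc_summable_PS_derive _ Hs) Hz)). ring.
- apply is_derive_ext with (2 := is_derive_minus_cpser _ z Hs Hz).
  intros w. symmetry. now apply Upsilon_minus_cpser.
Qed.

(** Membership thus becomes starlikeness of order [eta] for the series with the mixed coefficients,
    a single function in place of two operators. *)
Lemma class_Q_quotient (tau p q : R) (xi kappa : nat) (c : nat -> R) (f : C -> C) (z : C) :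
  0 < p -> p < q -> q <= 1 -> 0 <= tau ->
  disc_summable c -> c 0%nat = 0 -> c 1%nat = 0 ->
  (forall w, in_disc w -> f w = (w - cpser c w)%C) -> in_disc z ->
  let U0 := Upsilon tau p q xi kappa f in
  let U1 := Upsilon tau p q xi (S kappa) f in
  quotient_at z
      (RtoC (1 - tau) * z * C_derive U0 z + RtoC tau * z * C_derive U1 z)%C
      (RtoC (1 - tau) * U0 z + RtoC tau * U1 z)%C
  = quotient_at z
      (z - cpser (fun n => INR n * (mixed_factor tau p q xi kappa n * c n))%R z)%C
      (z - cpser (fun n => mixed_factor tau p q xi kappa n * c n)%R z)%C.
Proof.
intros Hp Hpq Hq Ht Hc H0 H1 Hf Hz U0 U1.
assert (Hs : forall k, disc_summable (fun n => Upsilon_factor tau p q xi k n * c n)).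
{ intros k. now apply disc_summable_Upsilon_factor. }
f_equal.
- rewrite <- !Cmult_assoc. unfold U0, U1.
  rewrite !(Upsilon_Euler tau p q xi _ c f z Hp Hpq Hq Ht Hc H0 H1 Hf Hz).
  rewrite (cpser_ext (fun n => INR n * (mixed_factor tau p q xi kappa n * c n))
    (fun n => (1 - tau) * (INR n * (Upsilon_factor tau p q xi kappa n * c n))
     + tau * (INR n * (Upsilon_factor tau p q xi (S kappa) n * c n)))).
  2:{ intros n. rewrite <- mixed_factor_linear. ring. }
  rewrite cpser_linear; auto using disc_summable_INR_mult.
  rewrite RtoC_minus. ring.
- unfold U0, U1. rewrite !(Upsilon_minus_cpser tau p q xi _ c f z Hc H0 H1 Hf).
  rewrite <- (cpser_ext _ _ z (mixed_factor_linear tau p q xi kappa c)).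
  rewrite cpser_linear; auto.
  rewrite RtoC_minus. ring.
Qed.

(** * The coefficient inequality *)

Definition single (nu : nat) (b : R) (n : nat) : R := if Nat.eqb n nu then b else 0.

Lemma single_same (nu : nat) (b : R) : single nu b nu = b.
Proof. unfold single. now rewrite Nat.eqb_refl. Qed.

Lemma single_other (nu n : nat) (b : R) : n <> nu -> single nu b n = 0.
Proof. intros H. unfold single. now apply Nat.eqb_neq in H as ->. Qed.

Lemma cpser_supported (a : nat -> R) (nu : nat) (z : C) :
  (forall n, n <> nu -> a n = 0) -> cpser a z = (RtoC (a nu) * z ^ nu)%C.
Proof.
intros H. apply cpser_unique.
apply (is_series_single (V := C_NormedModule) (fun n => (RtoC (a n) * z ^ n)%C) nu).
intros n Hn. rewrite H by auto. change (RtoC 0 * z ^ n = RtoC 0)%C. ring.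
Qed.

Lemma ex_series_supported (a : nat -> R) (nu : nat) (r : R) :
  (forall n, n <> nu -> a n = 0) -> ex_series (fun n => Rabs (a n) * r ^ n).
Proof.
intros H. exists (Rabs (a nu) * r ^ nu).
apply (is_series_single (V := R_NormedModule) (fun n => Rabs (a n) * r ^ n) nu).
intros n Hn. rewrite H, Rabs_R0 by auto. apply Rmult_0_l.
Qed.

Lemma Series_supported (a : nat -> R) (nu : nat) :
  (forall n, n <> nu -> a n = 0) -> Series a = a nu.
Proof.
intros H. apply is_series_unique.
exact (is_series_single (V := R_NormedModule) a nu H).
Qed.

Lemma class_T_cpser (f : C -> C) :
  class_T f ->
  exists c : nat -> R, (forall n, 0 <= c n) /\ c 0%nat = 0 /\ c 1%nat = 0 /\
    disc_summable c /\ forall z, in_disc z -> f z = (z - cpser c z)%C.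
Proof.
intros [_ [c0 [Hpos Hser]]].
(* [class_T] leaves the values at indices 0 and 1 arbitrary; they are reset to 0. *)
set (c := fun n => match n with S (S _) => c0 n | _ => 0 end).
assert (Hc : forall n, 0 <= c n).
{ intros [|[|n]]; simpl; try lra. apply Hpos. lia. }
assert (Hs : forall z, in_disc z -> is_series (fun n => (RtoC (c n) * z ^ n)%C) (z - f z)%C).
{ intros z Hz. apply is_series_C_unshift; [simpl; ring|].
  apply is_series_C_unshift; [simpl; ring|]. now apply Hser. }
exists c. repeat split; auto.
(* The coefficients are nonnegative, so convergence at the real point [r] is already absolute
   convergence. *)
- intros r Hr.
  assert (Hz : in_disc (RtoC r)) by (unfold in_disc; rewrite Cmod_R, Rabs_pos_eq; lra).
  destruct (is_series_C_components _ _ (Hs _ Hz)) as [H _].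
  eexists. apply is_series_ext with (2 := H).
  intros n. rewrite <- RtoC_pow, Rabs_pos_eq by auto. 
  unfold Re, Cmult, RtoC, fst, snd. change (@eq R (c n * r ^ n - 0 * 0) (c n * r ^ n)). ring.
- intros z Hz. rewrite (cpser_unique _ _ _ (Hs z Hz)). ring.
Qed.

(** Both terms vanish at 0, so the sign is read off after division by x: one minus the shifted
    series equals 1 at 0, and a negative value would force a zero inside the interval. *)
Lemma minus_PSeries_pos (a : nat -> R) :
  disc_summable a -> a 0%nat = 0 -> a 1%nat = 0 ->
  (forall x, 0 < x < 1 -> x - PSeries a x <> 0) ->
  forall x, 0 < x < 1 -> 0 < x - PSeries a x.
Proof.
intros Ha H0 H1 Hnz x Hx.
assert (CV : forall y, 0 <= y < 1 -> Rbar_lt (Rabs y) (CV_radius a)).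
{ intros y Hy. apply CV_radius_disc_summable; auto. rewrite Rabs_pos_eq; lra. }
assert (E : forall y, 0 <= y < 1 -> PSeries a y = y * PSeries (PS_decr_1 a) y).
{ intros y Hy. rewrite PSeries_decr_1, H0; [ring|]. apply CV_radius_inside; auto. }
destruct (Rtotal_order (x - PSeries a x) 0) as [H|[H|H]]; auto; exfalso.
- rewrite E in H by lra.
  destruct (IVT_interv (fun y => PSeries (PS_decr_1 a) y - 1) 0 x) as [y [Hy Ey]]; try nra.
  + intros y Hy. apply continuity_pt_minus.
    * apply PSeries_continuity. rewrite CV_radius_decr_1. apply CV. lra.
    * apply continuity_pt_const. now intros ? ?.
  + rewrite PSeries_0. unfold PS_decr_1. lra.
  + destruct (Req_dec y 0) as [->|Hy0].
    * rewrite PSeries_0 in Ey. unfold PS_decr_1 in Ey. lra.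
    * apply (Hnz y); [lra|]. rewrite E by lra. nra.
- now apply (Hnz x).
Qed.

(* Let [x] tend to 1 along the positive reals, where both sides of the quotient
   are real and the denominator is positive. *)
Lemma coefficient_inequality (a : nat -> R) (eta : R) :
  (forall n, 0 <= a n) -> disc_summable a -> a 0%nat = 0 -> a 1%nat = 0 ->
  0 <= eta < 1 ->
  (forall z, in_disc z ->
     eta < Re (quotient_at z (z - cpser (fun n => INR n * a n)%R z)%C (z - cpser a z)%C)) ->
  forall N, sum_n (fun n => (INR n - eta) * a n) N <= 1 - eta.
Proof.
intros Hpos Ha H0 H1 Heta HQ.
assert (Hn := disc_summable_INR_mult a Ha).
assert (HR : forall x, 0 < x < 1 ->
  eta < Re (RtoC (x - PSeries (fun n => INR n * a n) x)%R / RtoC (x - PSeries a x)%R)%C).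
{ intros x Hx.
  assert (Hz : in_disc (RtoC x)) by (unfold in_disc; rewrite Cmod_R, Rabs_pos_eq; lra).
  assert (H := HQ _ Hz). unfold quotient_at in H.
  destruct (Ceq_dec (RtoC x) (RtoC 0)) as [E|_]; [apply RtoC_inj in E; lra|].
  rewrite !cpser_real, <- !RtoC_minus in H. exact H. }
assert (Hp : forall x, 0 < x < 1 -> 0 < x - PSeries a x).
{ apply minus_PSeries_pos; auto.
  (* A zero denominator makes the quotient 0, since [Cinv] sends 0 to 0; this contradicts
     [0 <= eta]. *)
  intros x Hx E. specialize (HR x Hx). rewrite E in HR.
  unfold Cdiv, Cinv, Cmult, RtoC, Re, fst, snd in HR. unfold Rdiv in HR. lra. }
assert (HS : forall x, 0 < x < 1 -> forall N,
  sum_n (fun n => (INR n - eta) * a n * x ^ n) N <= (1 - eta) * x).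
{ intros x Hx N. specialize (HR x Hx). specialize (Hp x Hx).
  rewrite <- RtoC_div in HR by lra. change (eta < (x - PSeries (fun n => INR n * a n) x) / (x - PSeries a x)) in HR.
  apply Rlt_div_r in HR; [|lra].
  assert (E1 : ex_series (fun n => a n * x ^ n)).
  { apply ex_series_ext with (2 := Ha x ltac:(lra)). intros n. now rewrite Rabs_pos_eq. }
  assert (E2 : ex_series (fun n => INR n * a n * x ^ n)).
  { apply ex_series_ext with (2 := Hn x ltac:(lra)). intros n.
    rewrite Rabs_pos_eq; auto. apply Rmult_le_pos; auto using pos_INR. }
  assert (E3 := ex_series_scal_l eta _ E1).
  assert (E4 := ex_series_minus (V := R_NormedModule) _ _ E2 E3).
  apply Rle_trans with (Series (fun n => (INR n - eta) * a n * x ^ n)).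
  - apply sum_n_le_Series.
    + intros [|n]; [rewrite H0; lra|].
      apply Rmult_le_pos; [apply Rmult_le_pos; auto|apply pow_le; lra].
      rewrite S_INR. assert (X := pos_INR n). lra.
    + apply ex_series_ext with (2 := E4). intros n.
      change (@eq R (INR n * a n * x ^ n - eta * (a n * x ^ n)) ((INR n - eta) * a n * x ^ n)). ring.
  - rewrite (Series_ext _ (fun n => INR n * a n * x ^ n - eta * (a n * x ^ n)))
      by (intros n; ring).
    rewrite Series_minus, Series_scal_l; auto.
    unfold PSeries in HR. lra. }
intros N. apply Rnot_lt_le. intros HN.
set (s := sum_n (fun n => (INR n - eta) * a n) N) in *.
(* For n <= N, x^N is at most x^n, so x^N can be pulled out of the partial sum. *)
assert (HX : forall x, 0 < x < 1 -> x ^ N * s <= 1 - eta).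
{ intros x Hx. apply Rle_trans with ((1 - eta) * x); [|nra].
  apply Rle_trans with (2 := HS x Hx N).
  assert (Hg : forall n, 0 <= (INR n - eta) * a n).
  { intros [|n]; [rewrite H0; lra|]. apply Rmult_le_pos; auto.
    rewrite S_INR. assert (X := pos_INR n). lra. }
  assert (HM : forall M, (M <= N)%nat -> x ^ N * sum_n (fun n => (INR n - eta) * a n) M
     <= sum_n (fun n => (INR n - eta) * a n * x ^ n) M).
  { assert (Hx' : forall M, (M <= N)%nat -> x ^ N <= x ^ M).
    { intros M HM. replace N with (M + (N - M))%nat by lia. rewrite pow_add.
      assert (0 < x ^ M) by (apply pow_lt; lra).
      assert (x ^ (N - M) <= 1) by (rewrite <- (pow1 (N - M)); apply pow_incr; lra). nra. }
    induction M as [|M IH]; intros HM.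
    - rewrite !sum_O. specialize (Hx' 0%nat HM). specialize (Hg 0%nat).
      rewrite Rmult_comm. now apply Rmult_le_compat_l.
    - rewrite !sum_Sn. unfold plus; cbn -[INR pow]. specialize (Hx' (S M) HM). specialize (Hg (S M)).
      specialize (IH ltac:(lia)). rewrite Rmult_plus_distr_l.
      apply Rplus_le_compat; auto. rewrite Rmult_comm. now apply Rmult_le_compat_l. }
  now apply HM. }
assert (HB : forall d k, 0 < d < 1 -> 1 - INR k * d <= (1 - d) ^ k).
{ intros d k Hd. induction k as [|k IH]; [simpl; lra|].
  rewrite S_INR. simpl pow. assert (X := pos_INR k). nra. }
assert (HNp := pos_INR N).
(* The limit is replaced by the one point x = 1 - d. By Bernoulli, x^N s loses at most N d s, which
   is at most half of the excess of [s] over 1 - [eta]; the [+ 1] covers N = 0. *)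
set (d := (s - (1 - eta)) / (2 * (INR N + 1) * s)).
assert (Hs : 0 < s) by lra.
assert (Ed : d * ((INR N + 1) * s) = (s - (1 - eta)) / 2) by (unfold d; field; lra).
assert (Hd0 : 0 < d) by (unfold d; apply Rdiv_lt_0_compat; nra).
assert (HNd : 0 <= INR N * (d * s)) by (apply Rmult_le_pos; nra).
assert (Hd1 : d < 1) by (apply (Rmult_lt_reg_r s); nra).
specialize (HX (1 - d) ltac:(lra)). specialize (HB d N ltac:(lra)).
assert ((1 - INR N * d) * s <= 1 - eta).
{ apply Rle_trans with (2 := HX). apply Rmult_le_compat_r; lra. }
nra.
Qed.

(** * The radius *)

Lemma class_A_minus_cpser (c : nat -> R) (f : C -> C) :
  disc_summable c -> c 0%nat = 0 -> c 1%nat = 0 ->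
  (forall z, f z = (z - cpser c z)%C) -> class_A f.
Proof.
intros Hc H0 H1 Hf.
assert (Hd : forall z, in_disc z -> is_derive f z (1 - cpser (PS_derive c) z)%C).
{ intros z Hz. apply is_derive_ext with (2 := is_derive_minus_cpser c z Hc Hz).
  intros w. now symmetry. }
repeat split.
- intros z Hz. eexists. now apply Hd.
- rewrite Hf, cpser_real, PSeries_0, H0. ring.
- rewrite (is_C_derive_unique _ _ _ (Hd (RtoC 0) ltac:(unfold in_disc; rewrite Cmod_0; lra))).
  rewrite cpser_real, PSeries_0. unfold PS_derive. rewrite H1, Rmult_0_r. ring.
Qed.

Lemma class_T_minus_cpser (c : nat -> R) (f : C -> C) :
  (forall n, 0 <= c n) -> disc_summable c -> c 0%nat = 0 -> c 1%nat = 0 ->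
  (forall z, f z = (z - cpser c z)%C) -> class_T f.
Proof.
intros Hpos Hc H0 H1 Hf. split; [now apply class_A_minus_cpser with c|].
exists c. split; auto.
intros z Hz.
assert (S := is_series_C_shift _ _ (is_series_C_shift _ _ (disc_summable_cpser c z Hc Hz))).
cbv beta in S. rewrite H0, H1 in S.
replace (z - f z)%C with (cpser c z - 0 * z ^ 0 - 0 * z ^ 1)%C; auto.
rewrite Hf. ring.
Qed.

Lemma weight_mixed_factor (p q tau eta : R) (xi kappa nu : nat) :
  weight p q xi kappa tau eta nu = (INR nu - eta) * mixed_factor tau p q xi kappa nu.
Proof. unfold weight, mixed_factor, Upsilon_factor. ring. Qed.

Section Radius.

(** [hbase] makes the mixed multipliers positive, so the mixed coefficients inherit the sign of
    those of [phi]. Since [2] = p + q may be below 1, a large [tau] could otherwise reverse it. *)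
Context (p q tau eta rho : R) (kappa xi : nat)
  (hp : 0 < p) (hpq : p < q) (hq : q <= 1) (htau : 0 <= tau)
  (heta : 0 <= eta < 1) (hrho : 0 <= rho < 1)
  (hbase : forall nu : nat, (2 <= nu)%nat -> 0 < 1 + (pq_number p q nu - 1) * tau).

Local Notation mixed := (mixed_factor tau p q xi kappa).
Local Notation wt := (weight p q xi kappa tau eta).
Local Notation rad := (radius_at p q xi kappa tau eta rho).
Local Notation rmin := (r2 p q xi kappa tau eta rho).

Lemma mixed_factor_pos (nu : nat) : (2 <= nu)%nat -> 0 < mixed nu.
Proof.
intros H. apply Rmult_lt_0_compat; auto.
apply Upsilon_factor_bounds; auto. lia.
Qed.

Lemma INR_ge_2 (nu : nat) : (2 <= nu)%nat -> 2 <= INR nu.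
Proof. apply (le_INR 2). Qed.

Lemma weight_pos (nu : nat) : (2 <= nu)%nat -> 0 < wt nu.
Proof.
intros H. rewrite weight_mixed_factor.
apply Rmult_lt_0_compat; [|now apply mixed_factor_pos].
assert (X := INR_ge_2 nu H). lra.
Qed.

(** Two degrees are added to those of [Upsilon_factor]: one for nu - eta, one for the mixing factor,
    which is at most (1 + tau) nu. *)
Lemma weight_le (nu : nat) : (2 <= nu)%nat ->
  wt nu <= (1 + tau) ^ S xi * INR nu ^ S (S (kappa + xi)).
Proof.
intros H. rewrite weight_mixed_factor. unfold mixed_factor.
assert (X := INR_ge_2 nu H).
assert (U := Upsilon_factor_bounds tau p q xi kappa nu hp hpq hq htau ltac:(lia)).
assert (P := pq_number_bounds p q nu hp hpq hq).
assert (Hb := hbase nu H).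
set (u := Upsilon_factor _ _ _ _ _ _) in *.
replace ((1 + tau) ^ S xi * INR nu ^ S (S (kappa + xi)))
  with (INR nu * ((1 + tau) ^ xi * INR nu ^ (kappa + xi) * ((1 + tau) * INR nu)))
  by (simpl; ring).
apply Rmult_le_compat; try lra.
- apply Rmult_le_pos; lra.
- apply Rmult_le_compat; try lra. nra.
Qed.

Lemma radius_at_pow (nu : nat) : (2 <= nu)%nat ->
  rad nu ^ (nu - 1) = (1 - rho) * wt nu / ((INR nu - rho) * (1 - eta)).
Proof.
intros H. assert (X := INR_ge_2 nu H). unfold radius_at.
set (b := _ / _).
assert (Hb : 0 < b).
{ unfold b. assert (W := weight_pos nu H).
  apply Rdiv_lt_0_compat; apply Rmult_lt_0_compat; lra. }
rewrite <- Rpower_pow by apply exp_pos.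
rewrite Rpower_mult, minus_INR by lia. simpl (INR 1).
replace (1 / (INR nu - 1) * (INR nu - 1)) with 1 by (field; lra).
now apply Rpower_1.
Qed.

Lemma radius_at_pos (nu : nat) : 0 < rad nu.
Proof. apply exp_pos. Qed.

(** [real] sends infinite values to 0, so both are excluded: the set contains [rad 2] and is bounded
    below by 0. *)
Lemma r2_is_glb :
  is_glb_Rbar (fun x => exists nu, (2 <= nu)%nat /\ x = rad nu) rmin.
Proof.
assert (G := Glb_Rbar_correct (fun x => exists nu, (2 <= nu)%nat /\ x = rad nu)).
unfold r2.
destruct (Glb_Rbar _) as [g| |] eqn:E; auto; exfalso; destruct G as [G1 G2].
- apply (G1 (rad 2)). exists 2%nat. auto.
- assert (H : Rbar_le 0 m_infty); [|exact H].
  apply G2. intros x [nu [_ ->]]. apply Rlt_le, radius_at_pos.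
Qed.

Lemma r2_le (nu : nat) : (2 <= nu)%nat -> rmin <= rad nu.
Proof. intros H. apply (proj1 r2_is_glb). now exists nu. Qed.

Lemma r2_lt (r : R) : rmin < r -> exists nu, (2 <= nu)%nat /\ rad nu < r.
Proof.
intros H. apply Classical_Prop.NNPP. intros Hn.
apply (Rlt_not_le _ _ H), (proj2 r2_is_glb r).
intros x [nu [Hnu ->]]. apply Rnot_lt_le. intros Hlt. apply Hn. now exists nu.
Qed.

(* The bases of the roots grow at most polynomially in [nu].  Without this bound
   [r2] could leave the disc, where membership in the class says nothing. *)
Lemma r2_le_1 : rmin <= 1.
Proof.
apply Rnot_lt_le. intros H.
set (t := / rmin).
assert (Ht : 0 < t < 1).
{ split; [apply Rinv_0_lt_compat; lra|]. unfold t. rewrite <- Rinv_1.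
  apply Rinv_lt_contravar; lra. }
set (k := S (S (kappa + xi))).
(* If [rmin] exceeded 1, its power nu - 1 would be at most a constant times nu^k; dividing by it
   gives 1 <= K nu^k t^nu. The factor [rmin] in [K] turns the exponent nu - 1 into nu. *)
set (K := (1 - rho) / (1 - eta) * (1 + tau) ^ S xi * rmin).
assert (HK : 0 < K).
{ unfold K. repeat apply Rmult_lt_0_compat; try lra.
  - apply Rinv_0_lt_compat; lra.
  - apply pow_lt; lra. }
(* nu^k t^nu tends to 0, being the general term of a convergent series. *)
assert (L := ex_series_lim_0 _ (disc_summable_INR_pow_mult _ k disc_summable_1 t ltac:(lra))).
apply is_lim_seq_spec in L.
destruct (L (mkposreal (/ K) (Rinv_0_lt_compat _ HK))) as [N HN]. cbn [pos] in HN.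
set (nu := (N + 2)%nat).
assert (Hnu : (2 <= nu)%nat) by (unfold nu; lia).
specialize (HN nu ltac:(unfold nu; lia)).
assert (X := INR_ge_2 nu Hnu).
assert (P : 0 < INR nu ^ k) by (apply pow_lt; lra).
assert (T : 0 < t ^ nu) by (apply pow_lt; lra).
rewrite Rminus_0_r, Rabs_pos_eq, Rmult_1_r, Rabs_pos_eq in HN; try lra.
2:{ apply Rmult_le_pos; [apply Rabs_pos|lra]. }
assert (B : rmin ^ (nu - 1) <= rad nu ^ (nu - 1)).
{ apply pow_incr. split; [lra|now apply r2_le]. }
rewrite radius_at_pow in B by auto.
assert (B2 : (1 - rho) * wt nu / ((INR nu - rho) * (1 - eta))
   <= (1 - rho) / (1 - eta) * (1 + tau) ^ S xi * INR nu ^ k).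
{ assert (W := weight_le nu Hnu). fold k in W. assert (W0 := weight_pos nu Hnu).
  replace ((1 - rho) * wt nu / ((INR nu - rho) * (1 - eta)))
    with ((1 - rho) / (1 - eta) * (wt nu / (INR nu - rho))) by (field; lra).
  rewrite Rmult_assoc. apply Rmult_le_compat_l.
  - apply Rlt_le, Rdiv_lt_0_compat; lra.
  - apply Rle_trans with (2 := W). apply Rle_div_l; nra. }
assert (E : rmin ^ (nu - 1) * (rmin * t ^ nu) = 1).
{ replace nu with (S (nu - 1)) at 2 by lia. unfold t. rewrite pow_inv. simpl pow. 
  field. split; [apply pow_nonzero|]; lra. }
assert (E2 : rmin ^ (nu - 1) * (rmin * t ^ nu)
   <= (1 - rho) / (1 - eta) * (1 + tau) ^ S xi * INR nu ^ k * (rmin * t ^ nu)).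
{ apply Rmult_le_compat_r; [|lra]. apply Rmult_le_pos; lra. }
rewrite E in E2.
replace ((1 - rho) / (1 - eta) * (1 + tau) ^ S xi * INR nu ^ k * (rmin * t ^ nu))
  with (K * (INR nu ^ k * t ^ nu)) in E2 by (unfold K; ring).
apply (Rmult_lt_compat_l K) in HN; auto. rewrite Rinv_r in HN by lra. lra.
Qed.

Lemma class_P_starlike (phi : C -> C) :
  class_P p q xi kappa tau eta phi -> starlike rho rmin phi.
Proof.
intros [[_ HQ] HT] z Hz.
destruct (Ceq_dec z (RtoC 0)) as [E0|E0].
{ unfold quotient_at. destruct (Ceq_dec z (RtoC 0)); [|contradiction]. simpl. lra. }
destruct (class_T_cpser phi HT) as [c [Hpos [H0 [H1 [Hc Hf]]]]].
assert (Hr1 := r2_le_1).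
assert (Hd : in_disc z) by (unfold in_disc; lra).
assert (Hr0 : 0 < Cmod z) by now apply Cmod_gt_0.
set (a := fun n => mixed n * c n).
assert (Ha : forall n, 0 <= a n).
{ intros [|[|n]]; unfold a; try (rewrite ?H0, ?H1; lra).
  apply Rmult_le_pos; auto. apply Rlt_le, mixed_factor_pos. lia. }
assert (HB : forall N, sum_n (fun n => (INR n - eta) * a n) N <= 1 - eta).
{ apply coefficient_inequality; auto.
  - now apply disc_summable_mixed_factor.
  - unfold a. rewrite H0. ring.
  - unfold a. rewrite H1. ring.
  - intros w Hw. specialize (HQ w Hw). cbv zeta in HQ.
    rewrite (class_Q_quotient tau p q xi kappa c phi w) in HQ; auto. }
(* [phi] agrees with its series only on the disc, so the derivative is taken by local agreement in
   the ball of radius 1 - |z|. *)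
assert (HD : C_derive phi z = (1 - cpser (PS_derive c) z)%C).
{ apply is_C_derive_unique.
  apply is_derive_ext_loc with (2 := is_derive_minus_cpser c z Hc Hd).
  assert (He : 0 < 1 - Cmod z) by (unfold in_disc in Hd; lra).
  exists (mkposreal _ He). intros w Hw. symmetry. apply Hf.
  change (Cmod (w - z)%C < 1 - Cmod z) in Hw.
  assert (T := Cmod_triangle z (w - z)%C).
  assert (Ew : forall u v : C, (u + (v - u))%C = v) by (intros; ring).
  rewrite Ew in T. unfold in_disc. eapply Rle_lt_trans; [exact T|lra]. }
rewrite HD, Hf by auto.
replace (z * (1 - cpser (PS_derive c) z))%C
  with (z - cpser (fun n => INR n * c n)%R z)%C.
2:{ rewrite (cpser_Euler _ z _ (disc_summable_cpser _ z (disc_summable_PS_derive _ Hc) Hd)). ring. }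
apply starlike_quotient_bound; auto; [lra|].
set (r := Cmod z) in *. set (s := (r + rmin) / 2).
assert (Hs : r < s < rmin) by (unfold s; lra).
assert (HE : ex_series (fun n => (INR n - rho) * c n * r ^ n)).
{ assert (X1 := Hc r ltac:(lra)). 
  assert (X2 := disc_summable_INR_mult c Hc r ltac:(lra)).
  apply ex_series_ext with (2 := ex_series_minus (V := R_NormedModule) _ _ X2 (ex_series_scal_l rho _ X1)).
  intros n. rewrite Rabs_pos_eq by (apply Rmult_le_pos; auto using pos_INR).
  rewrite Rabs_pos_eq by auto.
  change (@eq R (INR n * c n * r ^ n - rho * (c n * r ^ n)) ((INR n - rho) * c n * r ^ n)). ring. }
(* Passing from [r] to the intermediate radius [s] gains the factor [r / s < 1],
   which makes the final inequality strict. *)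
set (M := r * (r / s) * ((1 - rho) / (1 - eta))).
assert (HM0 : 0 < M).
{ unfold M. repeat apply Rmult_lt_0_compat; try lra; apply Rinv_0_lt_compat; lra. }
assert (Hterm : forall n, (INR n - rho) * c n * r ^ n <= M * ((INR n - eta) * a n)).
{ intros [|[|n]]; [unfold a; rewrite H0; lra|unfold a; rewrite H1; lra|].
  set (nu := S (S n)). assert (Hnu : (2 <= nu)%nat) by (unfold nu; lia).
  assert (X := INR_ge_2 nu Hnu).
  assert (Es : s ^ S n <= (1 - rho) * wt nu / ((INR nu - rho) * (1 - eta))).
  { rewrite <- radius_at_pow by auto. replace (nu - 1)%nat with (S n) by (unfold nu; lia).
    apply pow_incr. split; [lra|]. apply Rle_trans with rmin; [lra|now apply r2_le]. }
  (* The exponent nu - 1 is at least 1, so one factor r / s can always be set aside. *)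
  assert (Er : r ^ S n <= r / s * s ^ S n).
  { assert (r ^ n <= s ^ n) by (apply pow_incr; lra). simpl pow.
    replace (r / s * (s * s ^ n)) with (r * s ^ n) by (field; lra).
    apply Rmult_le_compat_l; lra. }
  assert (Hrs : 0 < r / s) by (apply Rdiv_lt_0_compat; lra).
  assert (Er2 : r ^ S n <= r / s * ((1 - rho) * wt nu / ((INR nu - rho) * (1 - eta)))).
  { apply Rle_trans with (1 := Er). apply Rmult_le_compat_l; lra. }
  unfold a.
  replace (M * ((INR nu - eta) * (mixed nu * c nu)))
    with (c nu * (INR nu - rho) * r * (r / s * ((1 - rho) * wt nu / ((INR nu - rho) * (1 - eta)))))
    by (rewrite weight_mixed_factor; unfold M; field; lra).
  replace ((INR nu - rho) * c nu * r ^ nu) with (c nu * (INR nu - rho) * r * r ^ S n)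
    by (unfold nu; simpl; ring).
  apply Rmult_le_compat_l; auto.
  apply Rmult_le_pos; [apply Rmult_le_pos; auto; lra|lra]. }
apply Rle_lt_trans with (M * (1 - eta)).
- apply Series_le_bound; auto. intros N.
  apply Rle_trans with (sum_n (fun n => M * ((INR n - eta) * a n)) N).
  + apply sum_n_m_le, Hterm.
  + rewrite (sum_n_mult_l (K := R_Ring) M). apply Rmult_le_compat_l; [lra|apply HB].
- replace (M * (1 - eta)) with ((1 - rho) * r * (r / s)) by (unfold M; field; lra).
  assert (r / s < 1) by (apply Rlt_div_l; lra).
  assert (0 < (1 - rho) * r) by (apply Rmult_lt_0_compat; lra).
  nra.
Qed.

(** * Sharpness *)

Lemma extremal_cpser (nu : nat) (z : C) :
  extremal p q xi kappa tau eta nu z = (z - cpser (single nu ((1 - eta) / wt nu)) z)%C.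
Proof.
unfold extremal. rewrite (cpser_supported _ nu).
- now rewrite single_same.
- intros n Hn. now apply single_other.
Qed.

(** The coefficient inequality is an equality here; the strict inequality at z comes from |z|^nu <
    |z|. *)
Lemma extremal_class_P (nu : nat) : (2 <= nu)%nat ->
  class_P p q xi kappa tau eta (extremal p q xi kappa tau eta nu).
Proof.
intros Hnu. assert (X := INR_ge_2 nu Hnu). assert (W := weight_pos nu Hnu).
set (c := single nu ((1 - eta) / wt nu)).
assert (Hcn : forall n, n <> nu -> c n = 0) by (intros; now apply single_other).
assert (Hc : disc_summable c) by (intros r _; now apply ex_series_supported with nu).
assert (H0 : c 0%nat = 0) by (apply Hcn; lia).
assert (H1 : c 1%nat = 0) by (apply Hcn; lia).
assert (Hb : 0 < (1 - eta) / wt nu) by (apply Rdiv_lt_0_compat; lra).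
assert (Hpos : forall n, 0 <= c n).
{ intros n. unfold c, single. destruct (Nat.eqb n nu); lra. }
assert (Hf := extremal_cpser nu). fold c in Hf.
split; [split|].
- now apply class_A_minus_cpser with c.
- intros z Hz. cbv zeta.
  rewrite (class_Q_quotient tau p q xi kappa c); auto.
  destruct (Ceq_dec z (RtoC 0)) as [E0|E0].
  { unfold quotient_at. destruct (Ceq_dec z (RtoC 0)); [|contradiction]. simpl. lra. }
  assert (Hr0 : 0 < Cmod z) by now apply Cmod_gt_0.
  unfold in_disc in Hz.
  apply starlike_quotient_bound; auto; try lra.
  + intros n. destruct (Nat.eq_dec n nu) as [->|Hn].
    * apply Rmult_le_pos; auto. now apply Rlt_le, mixed_factor_pos.
    * rewrite Hcn by auto. lra.
  + rewrite H0. ring.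
  + now apply disc_summable_mixed_factor.
  + rewrite (Series_supported _ nu).
    * unfold c. rewrite single_same.
      rewrite <- Rmult_assoc, <- weight_mixed_factor.
      replace (wt nu * ((1 - eta) / wt nu)) with (1 - eta) by (field; lra).
      apply Rmult_lt_compat_l; [lra|].
      replace nu with (S (S (nu - 2))) by lia.
      assert (0 < Cmod z ^ (nu - 2) <= 1).
      { split; [now apply pow_lt|]. rewrite <- (pow1 (nu - 2)). apply pow_incr. lra. }
      simpl. nra.
    * intros n Hn. rewrite Hcn by auto. ring.
- now apply class_T_minus_cpser with c.
Qed.

(** At x = [rad nu] one has b x^(nu-1) = (1 - rho) / (nu - rho). Then (1 - nu b x^(nu-1)) / (1 - b
    x^(nu-1)) equals [rho], and the required strict inequality fails. *)
Lemma extremal_not_starlike (nu : nat) (r : R) : (2 <= nu)%nat ->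
  rad nu < r -> ~ starlike rho r (extremal p q xi kappa tau eta nu).
Proof.
intros Hnu Hr HS. assert (X := INR_ge_2 nu Hnu). assert (W := weight_pos nu Hnu).
assert (HR := radius_at_pos nu). assert (HP := radius_at_pow nu Hnu).
set (x := rad nu) in *.
set (b := (1 - eta) / wt nu).
assert (Hbx : b * x ^ nu = x * ((1 - rho) / (INR nu - rho))).
{ replace nu with (S (nu - 1)) at 1 by lia. simpl pow. rewrite HP. unfold b. field. lra. }
assert (Hx : Cmod (RtoC x) < r) by (rewrite Cmod_R, Rabs_pos_eq; lra).
specialize (HS _ Hx).
rewrite (is_C_derive_unique _ _ (1 - cpser (PS_derive (single nu b)) (RtoC x))%C) in HS.
2:{ apply is_derive_ext with (fun z => (z - cpser (single nu b) z)%C).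
    - intros z. symmetry. apply extremal_cpser.
    - apply is_derive_C_minus; [apply is_derive_C_id|].
      (* [x] may lie outside the unit disc; a finitely supported series converges at every radius,
         so [r] itself serves. *)
      apply is_derive_cpser with r; auto.
      apply ex_series_supported with nu. intros; now apply single_other. }
rewrite (cpser_supported _ (nu - 1)) in HS.
2:{ intros n Hn. unfold PS_derive. rewrite single_other by lia. ring. }
unfold PS_derive, extremal in HS. replace (S (nu - 1)) with nu in HS by lia.
rewrite single_same in HS. fold b in HS.
unfold quotient_at in HS.
destruct (Ceq_dec (RtoC x) (RtoC 0)) as [E|_]; [apply RtoC_inj in E; lra|].
rewrite <- !RtoC_pow, <- !RtoC_mult, <- !RtoC_minus, <- RtoC_mult, Hbx in HS.
assert (HN : x * (1 - INR nu * b * x ^ (nu - 1)) = x - INR nu * (x * ((1 - rho) / (INR nu - rho)))).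
{ rewrite <- Hbx. replace nu with (S (nu - 1)) at 4 by lia. simpl pow. ring. }
rewrite HN in HS.
assert (HD : x - x * ((1 - rho) / (INR nu - rho)) = x * (INR nu - 1) / (INR nu - rho)) by (field; lra).
assert (HD0 : 0 < x * (INR nu - 1) / (INR nu - rho)).
{ apply Rdiv_lt_0_compat; [apply Rmult_lt_0_compat|]; lra. }
rewrite <- RtoC_div in HS by lra.
simpl Re in HS. rewrite HD in HS.
replace ((x - INR nu * (x * ((1 - rho) / (INR nu - rho)))) / (x * (INR nu - 1) / (INR nu - rho)))
  with rho in HS by (field; lra).
lra.
Qed.

End Radius.

Theorem theorem6p2 (p q tau eta rho : R) (kappa xi : nat)
  (hp : 0 < p) (hpq : p < q) (hq : q <= 1)
  (htau : 0 <= tau)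
  (heta0 : 0 <= eta) (heta1 : eta < 1)
  (hrho0 : 0 <= rho) (hrho1 : rho < 1)
  (* the bases of the roots defining [r2] are positive *)
  (hbase : forall nu : nat, (2 <= nu)%nat ->
     0 < 1 + (pq_number p q nu - 1) * tau) :
  (forall phi : C -> C,
     class_P p q xi kappa tau eta phi ->
     starlike rho (r2 p q xi kappa tau eta rho) phi)
  /\
  (forall nu : nat, (2 <= nu)%nat ->
     class_P p q xi kappa tau eta (extremal p q xi kappa tau eta nu) /\
     forall r : R, radius_at p q xi kappa tau eta rho nu < r ->
       ~ starlike rho r (extremal p q xi kappa tau eta nu))
  /\
  (forall r : R, r2 p q xi kappa tau eta rho < r ->
     exists nu : nat, (2 <= nu)%nat /\
       class_P p q xi kappa tau eta (extremal p q xi kappa tau eta nu) /\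
       ~ starlike rho r (extremal p q xi kappa tau eta nu)).
Proof.
assert (heta : 0 <= eta < 1) by (split; assumption).
assert (hrho : 0 <= rho < 1) by (split; assumption).
split; [|split].
- intros phi. now apply class_P_starlike.
- intros nu Hnu. split; [now apply extremal_class_P|].
  intros r. now apply extremal_not_starlike.
- intros r Hr.
  (* The infimum need not be attained, so the index of the extremal function depends on [r]. *)
  edestruct r2_lt as [nu [Hnu Hlt]]; [..|exact Hr|]; try assumption.
  exists nu. split; [exact Hnu|]. split; [now apply extremal_class_P|].
  now apply extremal_not_starlike.
Qed.
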